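(* Let $G\le \mathrm{Aut}(\mathcal{T}_d)$ be a finitely generated, coarsely diagonal, self-similar group. Then the Röver–Nekrashevych group $V_d(G)$ has finite abelianization.
   Context: Let $X$ be an alphabet with $d\ge 2$ letters, identified with $\{1,\dots,d\}$ and totally ordered; $X^*$ (finite words) is the vertex set of the rooted $d$-ary tree $\mathcal{T}_d$ (root the empty word, $u$ adjacent to $ux$), ordered lexicographically. Every $f\in\mathrm{Aut}(\mathcal{T}_d)$ has a wreath recursion $f=\rho(f)(f_1,\dots,f_d)$ with $\rho(f)\in S_d$, $f_i\in\mathrm{Aut}(\mathcal{T}_d)$ determined by $f(iw)=\rho(f)(i)f_i(w)$; the $f_i$ are the level-1 states, and the states of $f$ form the smallest set containing $f$ closed under taking level-1 states. $G$ is self-similar if it contains all states of its elements, and coarsely diagonal if for every $g\in G$ and every state $g'$ of $g$, the element $(g')^{-1}g$ has finite order. Let $X^\omega$ be the set of infinite words. A finite subtree is rooted if it contains the root and complete if $ux\in T$ implies $uy\in T$ for all $y\in X$. For finite complete rooted subtrees $T_-,T_+$ with $n$ leaves $u_1,\dots,u_n$ and $v_1,\dots,v_n$ (lexicographic order), $\sigma\in S_n$, $g_i\in G$, $[T_-,\sigma(g_1,\dots,g_n),T_+]$ denotes the homeomorphism of $X^\omega$ with $v_iw\mapsto u_{\sigma(i)}g_i(w)$; $V_d(G)$ is the group of all such homeomorphisms. *)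

(* Defs.v *)
From mathcomp Require Import all_boot all_order all_fingroup.
Set Implicit Arguments. Unset Strict Implicit. Unset Printing Implicit Defensive.

Section TreeDefs.
Variable d : nat.

(* Vertices of the rooted d-ary tree: finite words over 'I_d (first letter
   first); the root is [::], the children of u are rcons u x. *)
Definition word := seq 'I_d.
Definition tfun := word -> word.
Definition iword := nat -> 'I_d.

Definition tadj (u v : word) : Prop :=
  (exists x, v = rcons u x) \/ (exists x, u = rcons v x).

Definition is_tree_aut (f : tfun) : Prop :=
  bijective f /\ f [::] = [::] /\ (forall u v, tadj u v <-> tadj (f u) (f v)).

(* level-1 state f_x : f (x :: w) = rho(f)(x) :: f_x w *)
Definition lvl1_state (f : tfun) (x : 'I_d) : tfun := fun w => behead (f (x :: w)).

Inductive state (f : tfun) : tfun -> Prop :=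
  | state_self : state f f
  | state_step g x : state f g -> state f (lvl1_state g x).

Definition subgroup_aut (G : tfun -> Prop) : Prop :=
  (forall f, G f -> is_tree_aut f) /\ G id /\
  (forall f g, G f -> G g -> G (f \o g)) /\
  (forall f g, G f -> cancel f g -> G g).

Inductive generated (k : nat) (gens : 'I_k -> tfun) : tfun -> Prop :=
  | gen_id : generated gens id
  | gen_mul i f : generated gens f -> generated gens (gens i \o f)
  | gen_inv i g f : cancel (gens i) g -> cancel g (gens i) ->
      generated gens f -> generated gens (g \o f).

Definition fin_generated (G : tfun -> Prop) : Prop :=
  exists k (gens : 'I_k -> tfun),
    (forall i, G (gens i)) /\ (forall f, G f -> generated gens f).

Definition self_similar (G : tfun -> Prop) : Prop :=
  forall g h, G g -> state g h -> G h.

Definition coarsely_diagonal (G : tfun -> Prop) : Prop :=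
  forall g g' g'inv, G g -> state g g' ->
    cancel g' g'inv -> cancel g'inv g' ->
    exists n, (0 < n)%N /\ iter n (g'inv \o g) = id.

(* action of a tree automorphism on infinite words (the letter of default is
   irrelevant since automorphisms preserve length) *)
Definition act (g : tfun) (om : iword) : iword :=
  fun n => nth (om 0%N) (g (mkseq om n.+1)) n.

Definition prepend (u : word) (om : iword) : iword :=
  fun n => if (n < size u)%N then nth (om 0%N) u n else om (n - size u)%N.

Fixpoint lex_le (u v : word) : bool :=
  match u, v with
  | [::], _ => true
  | _ :: _, [::] => false
  | x :: u', y :: v' => (x < y)%N || ((x == y) && lex_le u' v')
  end.

Definition complete_rooted_subtree (T : seq word) : Prop :=
  [::] \in T /\
  (forall u x, rcons u x \in T -> u \in T) /\
  (forall u x y, rcons u x \in T -> rcons u y \in T).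

Definition leaves (T : seq word) : seq word :=
  sort lex_le [seq u <- undup T | all (fun x => rcons u x \notin T) (enum 'I_d)].

Definition is_Vd_elt (G : tfun -> Prop) (phi : iword -> iword) : Prop :=
  exists (Tm Tp : seq word) (n : nat) (sigma : 'S_n) (gs : 'I_n -> tfun),
    complete_rooted_subtree Tm /\ complete_rooted_subtree Tp /\
    size (leaves Tm) = n /\ size (leaves Tp) = n /\
    (forall i, G (gs i)) /\
    forall (i : 'I_n) (w : iword),
      phi (prepend (nth [::] (leaves Tp) i) w) =
      prepend (nth [::] (leaves Tm) (sigma i)) (act (gs i) w).

Inductive comm_sub (V : (iword -> iword) -> Prop) : (iword -> iword) -> Prop :=
  | comm_id : comm_sub V id
  | comm_gen a a' b b' : V a -> V b -> cancel a a' -> cancel a' a ->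
      cancel b b' -> cancel b' b -> comm_sub V (a' \o b' \o a \o b)
  | comm_mul x y : comm_sub V x -> comm_sub V y -> comm_sub V (x \o y)
  | comm_inv x x' : comm_sub V x -> cancel x x' -> cancel x' x -> comm_sub V x'.

Definition finite_abelianization (V : (iword -> iword) -> Prop) : Prop :=
  exists m (reps : 'I_m -> (iword -> iword)),
    (forall j, V (reps j)) /\
    forall v, V v -> exists j c, comm_sub V c /\ v = reps j \o c.

End TreeDefs.

(* Main.v *)
From HB Require Import structures.
Require Import Defs.
From mathcomp Require Import all_boot all_order all_fingroup.
From mathcomp Require Import ssralg boolp zify.
(* [act] of Defs would otherwise be hidden by the group actions of fingroup. *)
Import Defs.
Set Implicit Arguments. Unset Strict Implicit. Unset Printing Implicit Defensive.
Import GRing.Theory.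

(* An element of V_d(G) given by a table v_i w |-> u_i g_i(w) is a product of swaps of
   two disjoint cones and of copies of elements of G acting in a single proper cone:
   precomposing with these one can send a caret (all children of a word p) of the
   domain table to a caret (all children of q) of the range table by a mere change of
   prefix, after which p w |-> q w replaces d rows by one.
   In the abelianization all swaps have the same class t, because cones can be moved
   by conjugation and a swap is the product of the d swaps of the children; also
   2 t = 0. The class Phi(g) of g acting in a proper cone does not depend on the cone,
   so Phi is a homomorphism, and splitting g at the first level gives
   Phi(g) = Phi(rho(g)) + sum_x Phi(g_x). Coarse diagonality makes each
   Phi(g) - Phi(g_x) torsion, whence (d - 1) Phi(g) is torsion. The abelianization is
   therefore generated by finitely many torsion elements: t and the Phi of the
   generators of G. *)

(** * Infinite words, cones, and the two elementary maps: swaps of cones and localizations to a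
    cone *)

Section Words.
Variable d : nat.
Implicit Types (u v w : word d) (om : iword d).

Definition shift (n : nat) om : iword d := fun k => om (n + k).

Lemma size_pre_mkseq u om n : mkseq (prepend u om) (size u + n) = u ++ mkseq om n.
Proof.
apply: (@eq_from_nth _ (om 0)); first by rewrite size_cat !size_mkseq.
move=> i; rewrite size_mkseq => lt_i.
rewrite nth_mkseq // nth_cat /prepend; case: ltnP => // le_i.
by rewrite nth_mkseq //; lia.
Qed.

Lemma mkseq_inj om1 om2 : (forall n, mkseq om1 n = mkseq om2 n) -> om1 = om2.
Proof.
move=> E; apply: funext => n; have := E n.+1.
by move/(congr1 (nth (om1 0) ^~ n)); rewrite !nth_mkseq.
Qed.

Lemma mkseq_inj_ge N om1 om2 :
  (forall n, mkseq om1 (N + n) = mkseq om2 (N + n)) -> om1 = om2.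
Proof.
move=> E; apply: funext => n; have := E n.+1.
by move/(congr1 (nth (om1 0) ^~ n)); rewrite !nth_mkseq //; lia.
Qed.

Lemma take_mkseq om m n : m <= n -> take m (mkseq om n) = mkseq om m.
Proof. by move=> le; rewrite /mkseq -map_take take_iota (minn_idPl le). Qed.

Lemma mkseq_prepend u om : mkseq (prepend u om) (size u) = u.
Proof. by have := size_pre_mkseq u om 0; rewrite addn0 cats0. Qed.

Lemma shift_prepend u om : shift (size u) (prepend u om) = om.
Proof.
by apply: funext => k; rewrite /shift /prepend ltnNge leq_addr /= addKn.
Qed.

Lemma prepend_mkseq_shift n om : prepend (mkseq om n) (shift n om) = om.
Proof.
apply: funext => k; rewrite /prepend /shift size_mkseq; case: ltnP => lt.
  by rewrite nth_mkseq.
by rewrite subnKC.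
Qed.

Lemma prepend_cat u v om : prepend (u ++ v) om = prepend u (prepend v om).
Proof.
apply: (@mkseq_inj_ge (size u + size v)) => n.
by rewrite -[in RHS]addnA !size_pre_mkseq -size_cat size_pre_mkseq catA.
Qed.

Lemma prepend_nil om : prepend [::] om = om.
Proof. by apply: funext => k; rewrite /prepend subn0. Qed.

Lemma prepend_inj u : injective (prepend u).
Proof. by move=> w1 w2 /(congr1 (shift (size u))); rewrite !shift_prepend. Qed.

Definition incomparable u v := ~~ prefix u v && ~~ prefix v u.

Lemma incomparableC u v : incomparable u v = incomparable v u.
Proof. by rewrite /incomparable andbC. Qed.

Lemma prepend_eq_prefix u v om om' :
  prepend u om = prepend v om' -> size u <= size v ->
  exists2 t, v = u ++ t & om = prepend t om'.
Proof.
move=> E le.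
have /prefixP[t Ev]: prefix u v.
  have := congr1 (fun o => mkseq o (size u)) E; rewrite mkseq_prepend.
  rewrite -(take_mkseq _ le) mkseq_prepend => {1}->; exact: prefix_take.
exists t => //; apply: (@prepend_inj u); rewrite E Ev; exact: prepend_cat.
Qed.

Lemma prepend_eq_comparable u v om om' :
  prepend u om = prepend v om' -> prefix u v || prefix v u.
Proof.
move=> E; case/orP: (leq_total (size u) (size v)) => le.
  by have [t -> _] := prepend_eq_prefix E le; rewrite prefix_prefix.
by have [t -> _] := prepend_eq_prefix (esym E) le; rewrite prefix_prefix orbT.
Qed.

Lemma incomparable_prepend u v om om' :
  incomparable u v -> prepend u om <> prepend v om'.
Proof.
by move=> /andP[/negPf nuv /negPf nvu] /prepend_eq_comparable; rewrite nuv nvu.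
Qed.

Definition in_cone u om := mkseq om (size u) == u.

Lemma in_coneP u om : reflect (exists om', om = prepend u om') (in_cone u om).
Proof.
apply: (iffP eqP) => [E|[om' ->]]; last exact: mkseq_prepend.
by exists (shift (size u) om); rewrite -{1}(prepend_mkseq_shift (size u) om) E.
Qed.

Lemma in_cone_prepend u om : in_cone u (prepend u om).
Proof. by apply/in_coneP; exists om. Qed.

Lemma in_cone_incomparable u v om : incomparable u v -> in_cone u (prepend v om) = false.
Proof.
move=> I; apply/negP => /in_coneP[om' /esym]; exact: incomparable_prepend.
Qed.

(** A total formula; it is treated as a bijection only for incomparable [u] and [v], where the order
    of the two tests is immaterial. *)
Definition swap u v om : iword d :=
  if in_cone u om then prepend v (shift (size u) om)
  else if in_cone v om then prepend u (shift (size v) om) else om.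

Definition localize u (f : iword d -> iword d) om : iword d :=
  if in_cone u om then prepend u (f (shift (size u) om)) else om.

Lemma swapl u v om : swap u v (prepend u om) = prepend v om.
Proof. by rewrite /swap in_cone_prepend shift_prepend. Qed.

Lemma swapr u v om : incomparable u v -> swap u v (prepend v om) = prepend u om.
Proof.
by move=> I; rewrite /swap in_cone_incomparable // in_cone_prepend shift_prepend.
Qed.

Lemma swap_out u v om : ~~ in_cone u om -> ~~ in_cone v om -> swap u v om = om.
Proof. by rewrite /swap => /negPf-> /negPf->. Qed.

Lemma swap_incomparable u v a om : incomparable u a -> incomparable v a ->
  swap u v (prepend a om) = prepend a om.
Proof. by move=> I J; rewrite swap_out // in_cone_incomparable. Qed.

Lemma swapK u v : incomparable u v -> cancel (swap u v) (swap u v).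
Proof.
move=> I om; case: (boolP (in_cone u om)) => [/in_coneP[w ->]|nu].
  by rewrite swapl swapr.
case: (boolP (in_cone v om)) => [/in_coneP[w ->]|nv].
  by rewrite swapr // swapl.
by rewrite !(swap_out nu nv).
Qed.

Lemma localize_in u f om : localize u f (prepend u om) = prepend u (f om).
Proof. by rewrite /localize in_cone_prepend shift_prepend. Qed.

Lemma localize_out u f om : ~~ in_cone u om -> localize u f om = om.
Proof. by rewrite /localize => /negPf->. Qed.

Lemma localize_incomparable u f a om :
  incomparable u a -> localize u f (prepend a om) = prepend a om.
Proof. by move=> I; rewrite localize_out // in_cone_incomparable. Qed.

Lemma localize_comp u f g : localize u (f \o g) = localize u f \o localize u g.
Proof.
apply: funext => om /=; case: (boolP (in_cone u om)) => [/in_coneP[w ->]|nu].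
  by rewrite !localize_in.
by rewrite !(localize_out _ nu).
Qed.

Lemma localize_id u : localize u id = id.
Proof.
apply: funext => om /=; case: (boolP (in_cone u om)) => [/in_coneP[w ->]|nu].
  by rewrite !localize_in.
by rewrite !(localize_out _ nu).
Qed.

Lemma localize_cat u v f : localize (u ++ v) f = localize u (localize v f).
Proof.
apply: funext => om; case: (boolP (in_cone u om)) => [/in_coneP[w ->]|nu].
  rewrite localize_in; case: (boolP (in_cone v w)) => [/in_coneP[w' ->]|nv].
    by rewrite localize_in -!prepend_cat localize_in.
  rewrite (localize_out _ nv) localize_out //; apply: contra nv.
  by case/in_coneP => w'; rewrite prepend_cat => /prepend_inj ->; exact: in_cone_prepend.
rewrite (localize_out _ nu) localize_out //; apply: contra nu.
by case/in_coneP => w ->; rewrite prepend_cat in_cone_prepend.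
Qed.

Lemma prefix_total u v a : prefix u a -> prefix v a -> prefix u v || prefix v u.
Proof.
case/prefixP => s -> /prefixP[t].
elim: u v => [|x u IH] [|y v] //= [-> /IH]; by rewrite eqxx.
Qed.

Lemma incomparable_catl u v t : incomparable u v -> incomparable (u ++ t) v.
Proof.
move=> /andP[nuv nvu]; apply/andP; split.
  by apply: contra nuv => /prefixP[s ->]; rewrite -catA prefix_prefix.
apply/negP => /prefix_total /(_ (prefix_prefix u t)).
by rewrite (negPf nuv) (negPf nvu).
Qed.

Lemma incomparable_catr u v t : incomparable u v -> incomparable u (v ++ t).
Proof. by rewrite incomparableC => /(incomparable_catl t); rewrite incomparableC. Qed.

Lemma prefix_cat2 u v w : prefix (u ++ v) (u ++ w) = prefix v w.
Proof. by elim: u => //= x u ->; rewrite eqxx. Qed.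

Lemma incomparable_cat2 u v w : incomparable (u ++ v) (u ++ w) = incomparable v w.
Proof. by rewrite /incomparable !prefix_cat2. Qed.

Lemma incomparable1 (x y : 'I_d) : incomparable [:: x] [:: y] = (x != y).
Proof. by rewrite /incomparable /= !andbT [y == x]eq_sym andbb. Qed.

Lemma incomparable_rcons u (x y : 'I_d) :
  incomparable (rcons u x) (rcons u y) = (x != y).
Proof. by rewrite -!cats1 incomparable_cat2 incomparable1. Qed.

End Words.

(** * Tree automorphisms, their sections and their action on infinite words *)

Section TreeAutomorphisms.
Variable d : nat.
Implicit Types (g : tfun d) (u v w : word d) (om : iword d).

(** Adjacency leaves open whether the image is a child or the parent of [g u]. The root has no
    parent; elsewhere the parent of [g u] is already the image of the parent of [u], so injectivity
    excludes it. *)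
Lemma tree_aut_rcons g u x : is_tree_aut g -> exists y, g (rcons u x) = rcons (g u) y.
Proof.
move=> [/bij_inj gI [g0 gA]]; elim/last_ind: u x => [|u z IH] x.
  have /gA[[y E]|[y E]] : tadj [::] (rcons [::] x) by left; exists x.
    by exists y.
  by move: E; rewrite g0; case: (g _).
have /gA[[y E]|[y E]] : tadj (rcons u z) (rcons (rcons u z) x) by left; exists x.
  by exists y.
have [z' E'] := IH z; move: E; rewrite E' => /rcons_inj[/gI/(congr1 size) + _].
by rewrite !size_rcons; lia.
Qed.

Lemma tree_aut_cat g u v : is_tree_aut g ->
  exists2 t, g (u ++ v) = g u ++ t & size t = size v.
Proof.
move=> gT; elim/last_ind: v => [|v x [t E st]]; first by exists [::]; rewrite ?cats0.
have [y Ey] := tree_aut_rcons (u ++ v) x gT.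
by exists (rcons t y); rewrite ?size_rcons ?st // -rcons_cat Ey E rcons_cat.
Qed.

Lemma tree_aut_nil g : is_tree_aut g -> g [::] = [::].
Proof. by case=> _ []. Qed.

Lemma tree_aut_size g u : is_tree_aut g -> size (g u) = size u.
Proof.
move=> gT; have [t] := tree_aut_cat [::] u gT.
by rewrite cat0s tree_aut_nil //= => ->.
Qed.

Lemma tree_aut_take g u n : is_tree_aut g -> g (take n u) = take n (g u).
Proof.
move=> gT; have [t] := tree_aut_cat (take n u) (drop n u) gT; rewrite cat_take_drop.
move=> E st; have sz: size (g (take n u)) = size (take n u) by exact: tree_aut_size.
case: (leqP n (size u)) => le.
  by rewrite E take_size_cat // sz size_takel.
by rewrite !take_oversize ?tree_aut_size // ltnW.
Qed.

Fixpoint section g v : tfun d :=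
  if v is x :: v' then section (lvl1_state g x) v' else g.

Lemma state_section f g v : state f g -> state f (section g v).
Proof. by elim: v g => //= x v IH g fg; apply: IH; apply: state_step. Qed.

(** [act] reads its letter [n] from the image of a prefix of length [n.+1]; these images are
    compatible because tree automorphisms commute with [take]. *)
Lemma mkseq_act g om n : is_tree_aut g -> mkseq (act g om) n = g (mkseq om n).
Proof.
move=> gT; apply: (@eq_from_nth _ (om 0)); rewrite ?size_mkseq ?tree_aut_size ?size_mkseq //.
move=> i lt; rewrite nth_mkseq // /act -(take_mkseq _ lt) tree_aut_take // nth_take //.
Qed.

Lemma act_id : act id = id :> (iword d -> iword d).
Proof.
by apply: funext => om; apply: funext => n; rewrite /act nth_mkseq.
Qed.

Lemma act_comp f g : is_tree_aut f -> is_tree_aut g -> is_tree_aut (f \o g) ->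
  act (f \o g) = act f \o act g.
Proof.
move=> fT gT fgT; apply: funext => om; apply: mkseq_inj => n.
by rewrite /= !mkseq_act.
Qed.

Section Group.
Variable G : tfun d -> Prop.
Hypotheses (Ggrp : subgroup_aut G) (Gss : self_similar G).

Lemma group_tree_aut g : G g -> is_tree_aut g.
Proof. by case: Ggrp => H _; exact: H. Qed.

Lemma group_id : G id.
Proof. by case: Ggrp => _ []. Qed.

Lemma group_comp f g : G f -> G g -> G (f \o g).
Proof. by case: Ggrp => _ [_ [H _]]; exact: H. Qed.

Lemma group_inv f : G f -> exists g, [/\ G g, cancel f g & cancel g f].
Proof.
move=> Gf; have [[g fK gK] _] := group_tree_aut Gf.
by exists g; split=> //; case: Ggrp => _ [_ [_ H]]; apply: H Gf fK.
Qed.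

Lemma group_section g v : G g -> G (section g v).
Proof. by move=> Gg; apply: (Gss Gg); apply: state_section; exact: state_self. Qed.

Lemma section_cat g u v : G g -> g (u ++ v) = g u ++ section g u v.
Proof.
elim: u g => [|x u IH] g Gg /=; first by rewrite tree_aut_nil //; exact: group_tree_aut.
have Gx : G (lvl1_state g x) by apply: (@group_section g [:: x]).
have gT := group_tree_aut Gg.
(* The wreath recursion: [g [:: x]] is a single letter, which is exactly what [behead] strips in
   [lvl1_state]. *)
have hd w : g (x :: w) = g [:: x] ++ lvl1_state g x w.
  have [t] := tree_aut_cat [:: x] w gT; rewrite /lvl1_state cat1s => -> _.
  by have := tree_aut_size [:: x] gT; case: (g [:: x]) => [|y []].
by rewrite (hd (u ++ v)) (hd u) IH // catA.
Qed.

Lemma act_prepend g u om : G g ->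
  act g (prepend u om) = prepend (g u) (act (section g u) om).
Proof.
move=> Gg; have gT := group_tree_aut Gg; apply: (@mkseq_inj_ge _ (size u)) => n.
rewrite mkseq_act // size_pre_mkseq section_cat //.
rewrite -(tree_aut_size u gT) size_pre_mkseq mkseq_act //.
exact/group_tree_aut/group_section.
Qed.

Lemma act_group_comp f g : G f -> G g -> act (f \o g) = act f \o act g.
Proof. by move=> Gf Gg; apply: act_comp; apply: group_tree_aut => //; exact: group_comp. Qed.

Lemma act_cancel f g : G f -> G g -> cancel f g -> cancel (act f) (act g).
Proof.
move=> Gf Gg fK om; have := act_group_comp Gg Gf.
have -> : g \o f = id by apply: funext => w; exact: fK.
by rewrite act_id => /(congr1 (fun F => F om)).
Qed.

Lemma act_bij g : G g -> bijective (act g).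
Proof.
by move=> Gg; have [h [Gh gK hK]] := group_inv Gg; exists (act h); exact: act_cancel.
Qed.

(** * Bijections acting on all sufficiently small cones by a change of prefix and an element of
    [G] *)

Definition prefix_action (f : iword d -> iword d) u v :=
  exists2 g, G g & forall om, f (prepend u om) = prepend v (act g om).

(* The elements of V_d(G) without trees: any table of a bijection can be refined to one
   whose domain is a full level of the tree. *)
Definition almost_aut (f : iword d -> iword d) :=
  bijective f /\ exists N, forall u, size u = N -> exists v, prefix_action f u v.

(** A row can be refined: under [t] the image prefix grows by [g t], and the section of [g] at [t]
    stays in [G] by self-similarity. *)
Lemma prefix_action_cat f u v t : prefix_action f u v ->
  exists2 t', size t' = size t & prefix_action f (u ++ t) (v ++ t').
Proof.
case=> g Gg E; exists (g t); first exact/tree_aut_size/group_tree_aut.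
exists (section g t); first exact: group_section.
by move=> w; rewrite prepend_cat E act_prepend // prepend_cat.
Qed.

Lemma prefix_action_comp f f' u v a : prefix_action f v a -> prefix_action f' u v ->
  prefix_action (f \o f') u a.
Proof.
move=> [g Gg E] [g' Gg' E']; exists (g \o g'); first exact: group_comp.
by move=> w; rewrite /= E' E act_group_comp.
Qed.

Lemma prefix_action_inv f f' u v : cancel f f' -> prefix_action f u v -> prefix_action f' v u.
Proof.
move=> fK [g Gg E]; have [h [Gh gK hK]] := group_inv Gg; exists h => // w.
by rewrite -{1}(act_cancel Gh Gg hK w) -E fK.
Qed.

(** Refining by [M] levels lengthens the image prefix by [M], so it can be made as long as a second
    map requires. *)
Lemma prefix_action_deep f N M : (forall u, size u = N -> exists v, prefix_action f u v) ->
  forall u, size u = N + M -> exists2 v, M <= size v & prefix_action f u v.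
Proof.
move=> H u su; have [|v Hv] := H (take N u); first by rewrite size_takel // su leq_addr.
have [t st Ht] := prefix_action_cat (drop N u) Hv; exists (v ++ t).
  by rewrite size_cat st size_drop su; lia.
by rewrite -(cat_take_drop N u).
Qed.

Lemma almost_aut_id : almost_aut id.
Proof.
split; first by exists id.
exists 0 => u _; exists u; exists id; first exact: group_id.
by move=> w; rewrite act_id.
Qed.

Lemma almost_aut_comp f f' : almost_aut f -> almost_aut f' -> almost_aut (f \o f').
Proof.
move=> [fB [N H]] [fB' [N' H']]; split; first exact: bij_comp.
(* The [N] extra levels make the image prefix [v] at least [N] long, so [f] has a row at [take N v],
   which is then refined to [v]. *)
exists (N' + N) => u su; have [v sv Hv] := prefix_action_deep H' su.
have [a Ha] := H (take N v) (size_takel sv).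
have [t _ Ht] := prefix_action_cat (drop N v) Ha; rewrite cat_take_drop in Ht.
by eexists; apply: prefix_action_comp Ht Hv.
Qed.

Lemma almost_aut_localize u f : almost_aut f -> almost_aut (localize u f).
Proof.
move=> [[f' fK f'K] [N H]]; split.
  exists (localize u f') => om.
    by have := localize_comp u f' f; rewrite (funext fK : f' \o f = id) localize_id
      => /(congr1 (fun F => F om)).
  by have := localize_comp u f f'; rewrite (funext f'K : f \o f' = id) localize_id
      => /(congr1 (fun F => F om)).
(* A word of this length either extends [u] by exactly [N] letters, where a row of [f] applies, or
   is incomparable with [u]. *)
exists (size u + N) => v sv.
case: (boolP (prefix u v)) => [/prefixP[t Ev]|nuv].
  have [|a [g Gg E]] := H t; first by move: sv; rewrite Ev size_cat; lia.
  by exists (u ++ a), g => // w; rewrite Ev !prepend_cat localize_in E.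
exists v, id; first exact: group_id.
move=> w; rewrite act_id localize_incomparable // /incomparable nuv /=.
apply: contra nuv; rewrite !prefixE sv => /eqP.
by rewrite take_oversize ?leq_addr // => ->; rewrite take_size.
Qed.

Lemma almost_aut_act g : G g -> almost_aut (act g).
Proof.
move=> Gg; split; first exact: act_bij.
by exists 0 => u /size0nil->; exists [::], g => // w; rewrite !prepend_nil.
Qed.

Lemma almost_aut_swap u v : incomparable u v -> almost_aut (swap u v).
Proof.
move=> I; split; first by exists (swap u v); exact: swapK.
exists (size u + size v) => a sa.
case: (boolP (prefix u a)) => [/prefixP[t Ea]|nu].
  exists (v ++ t), id; first exact: group_id.
  by move=> w; rewrite Ea !prepend_cat swapl act_id.
case: (boolP (prefix v a)) => [/prefixP[t Ea]|nv].
  exists (u ++ t), id; first exact: group_id.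
  by move=> w; rewrite Ea !prepend_cat swapr // act_id.
exists a, id; first exact: group_id.
move=> w; rewrite act_id swap_incomparable // /incomparable ?nu ?nv /=.
  apply: contra nu; rewrite !prefixE sa => /eqP.
  by rewrite take_oversize ?leq_addr // => ->; rewrite take_size.
apply: contra nv; rewrite !prefixE sa => /eqP.
by rewrite take_oversize ?leq_addl // => ->; rewrite take_size.
Qed.

(** The image cones of the rows at level [N] cover everything, so a word as long as the longest
    image prefix extends one of them, and the inverted row can be refined to it. *)
Lemma almost_aut_inv f f' : almost_aut f -> cancel f f' -> cancel f' f -> almost_aut f'.
Proof.
move=> [fB [N H]] fK f'K; split; first by exists f.
have /choice[F HF] : forall u, exists v, size u = N -> prefix_action f u v.
  move=> u; case: (eqVneq (size u) N) => [/H[v Hv]|/eqP n]; first by exists v.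
  by exists u => /n.
pose M := \max_(t : N.-tuple 'I_d) size (F t).
(* For [d = 0] there are no infinite words and any row holds vacuously; otherwise a letter is
   available to pad [v]. *)
exists M => v sv; case: (posnP d) => [d0|d0].
  case: v sv => [|x v]; last by exfalso; have := ltn_ord x; rewrite {2}d0.
  move=> _; exists [::]; exists id; first exact: group_id.
  by move=> w; exfalso; have := ltn_ord (w 0); rewrite {2}d0.
pose om := prepend v (fun=> Ordinal d0).
(* The row of [f] whose image cone contains the padded word is read off from the preimage of that
   word. *)
pose u := mkseq (f' om) N.
have su : size u = N by rewrite size_mkseq.
have Hu := HF _ su; have [g Gg E] := Hu.
have E1 : om = prepend (F u) (act g (shift N (f' om))).
  by rewrite -E prepend_mkseq_shift f'K.
have sF : size (F u) <= size v.
  rewrite sv; have /eqP su' := su.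
  by apply: (@leq_bigmax _ (fun t : N.-tuple 'I_d => size (F t)) (Tuple su')).
have [t -> _] := prepend_eq_prefix (esym E1) sF.
have := prefix_action_inv fK Hu.
by move/(prefix_action_cat t) => [t' _ Ht']; exists (u ++ t').
Qed.

End Group.
End TreeAutomorphisms.

(** * The abelianization of a group of bijections, as an additive group *)

Section Abelianization.
Variables (d : nat) (V : (iword d -> iword d) -> Prop).
Hypotheses (V1 : V id) (VM : forall x y, V x -> V y -> V (x \o y))
  (VV : forall x, V x -> exists y, [/\ V y, cancel x y & cancel y x]).

Lemma comm_sub_mem x : comm_sub V x -> V x.
Proof.
(* The constructors of [comm_sub] allow any two-sided inverse; it coincides with the one that [VV]
   provides in [V]. *)
have inv z z' : V z -> cancel z z' -> cancel z' z -> V z'.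
  move=> /VV[y [Vy zK yK]] zK' z'K; suff -> : z' = y by [].
  by apply: funext => t; rewrite -{1}(yK t) zK'.
elim=> [|a a' b b' Va Vb aK a'K bK b'K|y z _ Vy _ Vz|y y' _ Vy yK y'K] //.
- by apply: (VM _ Vb); apply: (VM _ Va); apply: VM;
    [exact: inv Va _ _ | exact: inv Vb _ _].
- exact: VM.
- exact: inv Vy _ _.
Qed.

Definition cls (x y : iword d -> iword d) := exists2 c, comm_sub V c & y = x \o c.

Lemma cls_refl x : cls x x.
Proof. by exists id => //; exact: comm_id. Qed.

Lemma comm_sub_inv c : comm_sub V c ->
  exists c', [/\ comm_sub V c', cancel c c' & cancel c' c].
Proof.
move=> Hc; have [c' [_ cK c'K]] := VV (comm_sub_mem Hc).
by exists c'; split=> //; apply: comm_inv Hc _ _.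
Qed.

Lemma cls_sym x y : cls x y -> cls y x.
Proof.
case=> c Hc ->; have [c' [Hc' cK c'K]] := comm_sub_inv Hc; exists c' => //.
by apply: funext => t /=; rewrite c'K.
Qed.

Lemma cls_trans x y z : cls x y -> cls y z -> cls x z.
Proof. by move=> [c Hc ->] [e He ->]; exists (c \o e) => //; exact: comm_mul. Qed.

(** Normality of the commutator subgroup: the conjugate of [c] is [c] times the commutator of [c]
    and [y]. *)
Lemma comm_sub_conj c y y' : comm_sub V c -> V y -> cancel y y' -> cancel y' y ->
  comm_sub V (y' \o c \o y).
Proof.
move=> Hc Vy yK y'K; have [c' [Hc' cK c'K]] := comm_sub_inv Hc.
have -> : y' \o c \o y = c \o (c' \o y' \o c \o y) by apply: funext => t /=; rewrite c'K.
by apply: comm_mul => //; apply: comm_gen => //; exact: comm_sub_mem.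
Qed.

(** Moving [c] to the right past [y] replaces it by its conjugate under [y]. *)
Lemma cls_comp x x1 y y1 : V x -> V y -> cls x x1 -> cls y y1 -> cls (x \o y) (x1 \o y1).
Proof.
move=> Vx Vy [c Hc ->] [e He ->]; have [y' [Vy' yK y'K]] := VV Vy.
exists ((y' \o c \o y) \o e); first by apply: comm_mul => //; exact: comm_sub_conj.
by apply: funext => t /=; rewrite y'K.
Qed.

Lemma cls_comm x y : V x -> V y -> cls (x \o y) (y \o x).
Proof.
move=> Vx Vy; have [x' [_ xK x'K]] := VV Vx; have [y' [_ yK y'K]] := VV Vy.
exists (y' \o x' \o y \o x) => //; first exact: comm_gen.
by apply: funext => t /=; rewrite y'K x'K.
Qed.

(** The quotient consists of the equivalence classes themselves, as predicates, so that equality in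
    it is plain equality. *)
Definition cosets := {S : (iword d -> iword d) -> Prop | exists2 x, V x & S = cls x}.

Lemma cosets_inj (q r : cosets) : sval q = sval r -> q = r.
Proof.
case: q r => [S p] [S' p'] /= E; move: p'; rewrite -E => p'.
by rewrite (Prop_irrelevance p p').
Qed.

(** The class of [id] is a default value outside [V]. *)
Definition coset (x : iword d -> iword d) : cosets :=
  match pselect (V x) with
  | left h => exist _ (cls x) (ex_intro2 _ _ x h erefl)
  | right _ => exist _ (cls id) (ex_intro2 _ _ id V1 erefl)
  end.

Definition coset_rep (q : cosets) : iword d -> iword d := s2val (cid2 (svalP q)).

Lemma coset_repV q : V (coset_rep q).
Proof. exact: s2valP. Qed.

Lemma cls_eq x y : cls x y -> cls x = cls y.
Proof.
move=> h; apply: funext => z; apply: propext; split; last exact: cls_trans.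
by apply: cls_trans; exact: cls_sym.
Qed.

Lemma coset_eq x y : V x -> V y -> coset x = coset y <-> cls x y.
Proof.
rewrite /coset => Vx Vy; case: pselect => // ?; case: pselect => // ?; split.
  by move/(congr1 sval) => /= ->; exact: cls_refl.
by move=> /cls_eq E; apply: cosets_inj.
Qed.

Lemma coset_repK q : coset (coset_rep q) = q.
Proof.
rewrite /coset; case: pselect => [h|]; last by case; exact: coset_repV.
by apply: cosets_inj => /=; rewrite -(s2valP' (cid2 (svalP q))).
Qed.

Lemma coset_repE x : V x -> cls x (coset_rep (coset x)).
Proof.
by move=> Vx; apply/coset_eq => //; [exact: coset_repV | rewrite coset_repK].
Qed.

Definition coset_add q r := coset (coset_rep q \o coset_rep r).

Lemma coset_comp x y : V x -> V y -> coset (x \o y) = coset_add (coset x) (coset y).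
Proof.
move=> Vx Vy; apply/coset_eq; [exact: VM|by apply: VM; exact: coset_repV|].
by apply: cls_comp => //; exact: coset_repE.
Qed.

Lemma cosetP q : exists2 x, V x & q = coset x.
Proof. by exists (coset_rep q); [exact: coset_repV|rewrite coset_repK]. Qed.

Lemma coset_addA : associative coset_add.
Proof.
move=> q r s; have [x Vx ->] := cosetP q; have [y Vy ->] := cosetP r.
have [z Vz ->] := cosetP s.
by rewrite -!coset_comp //; exact: VM.
Qed.

Lemma coset_addC : commutative coset_add.
Proof.
move=> q r; have [x Vx ->] := cosetP q; have [y Vy ->] := cosetP r.
by rewrite -!coset_comp //; apply/coset_eq; [exact: VM|exact: VM|exact: cls_comm].
Qed.

Lemma coset_add0 : left_id (coset id) coset_add.
Proof. by move=> q; have [x Vx ->] := cosetP q; rewrite -coset_comp. Qed.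

Lemma coset_invP q : exists r, coset_add r q = coset id.
Proof.
have [x Vx ->] := cosetP q; have [y [Vy xK yK]] := VV Vx.
exists (coset y); rewrite -coset_comp //; congr coset.
by apply: funext => t; exact: xK.
Qed.

Definition coset_opp q := projT1 (cid (coset_invP q)).

Lemma coset_addN : left_inverse (coset id) coset_opp coset_add.
Proof. by move=> q; rewrite /coset_opp; case: cid. Qed.

Lemma abelianization_exists : exists (Q : zmodType) (cl : (iword d -> iword d) -> Q),
  (forall x y, V x -> V y -> cl (x \o y) = (cl x + cl y)%R) /\
  (forall x, V x -> cl x = 0%R -> comm_sub V x).
Proof.
pose Q0 := classicType cosets.
pose M := GRing.isZmodule.Build Q0 coset_addA coset_addC coset_add0 coset_addN.
pose Q : zmodType := HB.pack Q0 M.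
exists Q, coset; split; first exact: coset_comp.
(* A zero class means [id = x \o c] with [c] in the commutator subgroup, so [x] is the inverse of
   [c]. *)
move=> x Vx /coset_eq[//|//|c Hc E].
have [c' [Hc' cK c'K]] := comm_sub_inv Hc.
suff -> : x = c' by [].
by apply: funext => t; rewrite -{1}(c'K t) -[x (c _)]/((x \o c) _) -E.
Qed.

End Abelianization.

(** * Relations between swaps, localizations and permutations of the first letter *)

Section Products.
Variable d : nat.
Implicit Types (u v w : word d) (om : iword d) (F : 'I_d -> iword d -> iword d).

Definition comps F (s : seq 'I_d) : iword d -> iword d :=
  foldr (fun x h => F x \o h) id s.

Lemma comps_fix F s om : (forall x, F x om = om) -> comps F s om = om.
Proof. by move=> H; elim: s => //= x s ->. Qed.

(** Only the factor at [x] moves the point: the factors applied earlier fix [om], those applied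
    later fix [F x om]. Hence the order of the alphabet does not matter. *)
Lemma comps_enum F x om : (forall y, y != x -> F y om = om) ->
  (forall y, y != x -> F y (F x om) = F x om) -> comps F (enum 'I_d) om = F x om.
Proof.
move=> H1 H2; have : x \in enum 'I_d by rewrite mem_enum.
have : uniq (enum 'I_d) by exact: enum_uniq.
elim: (enum _) => //= y s IH /andP[ys us]; rewrite inE => /orP[/eqP xy|xs].
  rewrite {}xy in H1 H2 *; congr (F y).
  elim: s ys {us IH} => //= z s IH; rewrite inE negb_or => /andP[yz ys].
  by rewrite IH // H1 // eq_sym.
by rewrite IH // H2 //; apply: contraNneq ys => ->.
Qed.

Lemma swapC u v : incomparable u v -> swap u v = swap v u.
Proof.
move=> I; apply: funext => om; have I' : incomparable v u by rewrite incomparableC.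
case: (boolP (in_cone u om)) => [/in_coneP[w ->]|nu]; first by rewrite swapl swapr.
case: (boolP (in_cone v om)) => [/in_coneP[w ->]|nv]; first by rewrite swapl swapr.
by rewrite !swap_out.
Qed.

(** The analogue of conjugating a transposition; it serves to move one of two swapped cones while
    the other stays in place. *)
Lemma swap_conj u v v' : incomparable u v -> incomparable u v' -> incomparable v v' ->
  swap v v' \o swap u v \o swap v v' = swap u v'.
Proof.
move=> I1 I2 I3; have [J1 [J2 J3]] : incomparable v u /\ incomparable v' u /\ incomparable v' v.
  by rewrite ![_ _ u]incomparableC [_ v' v]incomparableC.
apply: funext => om /=.
case: (boolP (in_cone u om)) => [/in_coneP[w ->]|nu].
  by rewrite [swap v v' (prepend u w)]swap_incomparable // !swapl.
case: (boolP (in_cone v om)) => [/in_coneP[w ->]|nv].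
  by rewrite swapl ![swap u _ _]swap_incomparable // swapr.
case: (boolP (in_cone v' om)) => [/in_coneP[w ->]|nv'].
  by rewrite !swapr // swap_incomparable.
by rewrite !(swap_out, nu, nv, nv').
Qed.

Lemma localize_conj u v f : incomparable u v ->
  swap u v \o localize u f \o swap u v = localize v f.
Proof.
move=> I; have J : incomparable v u by rewrite incomparableC.
apply: funext => om /=.
case: (boolP (in_cone u om)) => [/in_coneP[w ->]|nu].
  by rewrite swapl !localize_incomparable // swapr.
case: (boolP (in_cone v om)) => [/in_coneP[w ->]|nv].
  by rewrite swapr // !localize_in swapl.
by rewrite (swap_out nu nv) (localize_out _ nu) (localize_out _ nv) swap_out.
Qed.

Lemma iword_cons om : exists x om', om = prepend [:: x] om'.
Proof. by exists (om 0), (shift 1 om); rewrite -[LHS](prepend_mkseq_shift 1). Qed.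

Lemma prepend_rcons u x om : prepend (rcons u x) om = prepend u (prepend [:: x] om).
Proof. by rewrite -cats1 prepend_cat. Qed.

(** Both cones are split into their children. Each child swap leaves free room outside its two
    cones, even when [u] and [v] together fill the tree, as can happen for [d = 2]. *)
Lemma swap_comps u v : incomparable u v ->
  swap u v = comps (fun x => swap (rcons u x) (rcons v x)) (enum 'I_d).
Proof.
move=> I; have Ix x y : incomparable (rcons u x) (rcons v y).
  by rewrite -!cats1; apply/incomparable_catl/incomparable_catr.
have Iy x y : incomparable (rcons v x) (rcons u y) by rewrite incomparableC.
apply: funext => om.
case: (boolP (in_cone u om)) => [/in_coneP[w ->]|nu].
  have [x [w' ->]] := iword_cons w; rewrite swapl -!prepend_rcons.
  rewrite (@comps_enum _ x) ?swapl // => y yx;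
    by rewrite swap_incomparable // incomparable_rcons.
case: (boolP (in_cone v om)) => [/in_coneP[w ->]|nv].
  have [x [w' ->]] := iword_cons w; rewrite swapr // -!prepend_rcons.
  rewrite (@comps_enum _ x) ?swapr // => y yx;
    by rewrite swap_incomparable // incomparable_rcons.
rewrite swap_out // comps_fix // => x; rewrite swap_out //.
  by apply: contra nu => /in_coneP[w ->]; rewrite prepend_rcons in_cone_prepend.
by apply: contra nv => /in_coneP[w ->]; rewrite prepend_rcons in_cone_prepend.
Qed.

(** The action on infinite words of the automorphism with root permutation [s] and trivial level-1
    states. *)
Definition letters (s : 'S_d) om : iword d := prepend [:: s (om 0)] (shift 1 om).

Lemma letters_prepend s x om : letters s (prepend [:: x] om) = prepend [:: s x] om.
Proof.
rewrite /letters (shift_prepend [:: x]); congr (prepend [:: s _] _).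
Qed.

(** The order is reversed because [(s * t)%g] applies [s] first. *)
Lemma letters_comp s t : letters (s * t)%g = letters t \o letters s.
Proof.
apply: funext => om; have [x [w ->]] := iword_cons om.
by rewrite /= !letters_prepend permM.
Qed.

Lemma letters_id : letters 1 = id.
Proof.
by apply: funext => om; have [x [w ->]] := iword_cons om; rewrite letters_prepend perm1.
Qed.

End Products.

(** * Values of an additive map [cl] on swaps and on localized elements, and torsion *)

Section Classes.
Variables (d : nat) (G : tfun d -> Prop).
Hypotheses (d_ge2 : 2 <= d) (Ggrp : subgroup_aut G) (Gss : self_similar G)
  (Gcd : coarsely_diagonal G).
Variables (Q : zmodType) (cl : (iword d -> iword d) -> Q).
Let V := almost_aut G.
Hypothesis clM : forall f g, V f -> V g -> cl (f \o g) = (cl f + cl g)%R.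
Implicit Types (u v w : word d) (om : iword d) (f : iword d -> iword d).
Local Open Scope ring_scope.

Let V1 : V id. Proof. exact: almost_aut_id. Qed.
Let VM f g : V f -> V g -> V (f \o g). Proof. exact: almost_aut_comp. Qed.
Let VS u v : incomparable u v -> V (swap u v). Proof. exact: almost_aut_swap. Qed.
Let VL u f : V f -> V (localize u f). Proof. exact: almost_aut_localize. Qed.

Lemma cl_id : cl id = 0.
Proof. by apply: (addrI (cl id)); rewrite addr0 -clM. Qed.

Lemma cl_swap2 u v : incomparable u v -> cl (swap u v) + cl (swap u v) = 0.
Proof.
move=> I; rewrite -clM; try exact: VS.
by rewrite -cl_id; congr cl; apply: funext => om /=; rewrite swapK.
Qed.

Lemma cl_conj u v f : incomparable u v -> V f ->
  cl (swap u v \o f \o swap u v) = cl f.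
Proof.
move=> I Vf; have VS' := VS I; rewrite (clM (VM VS' Vf) VS') (clM VS' Vf).
by rewrite addrAC cl_swap2 // add0r.
Qed.

Lemma cl_comps F s : (forall x, V (F x)) ->
  V (comps F s) /\ cl (comps F s) = \sum_(x <- s) cl (F x).
Proof.
move=> VF; elim: s => [|x s [IHV IH]]; first by rewrite big_nil; split=> //; exact: cl_id.
by rewrite big_cons /= clM // IH; split=> //; exact: VM.
Qed.

Lemma letter_neq (x : 'I_d) : exists y, x != y.
Proof.
have d0 : (0 < d)%N by lia.
case: (eqVneq x (Ordinal d0)) => [->|h]; last by exists (Ordinal d0).
by exists (Ordinal d_ge2).
Qed.

Lemma incomparable_cons (x y : 'I_d) u v : x != y -> incomparable (x :: u) (y :: v).
Proof. by move=> xy; rewrite /incomparable /= [y == x]eq_sym (negPf xy). Qed.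

(* Comparable nonempty words share their first letter, so both are incomparable to any
   one-letter word different from it. *)
Lemma incomparable_const (R : Type) (c : word d -> R) :
  (forall u v, incomparable u v -> c u = c v) ->
  forall u v, u != [::] -> v != [::] -> c u = c v.
Proof.
move=> H [|x u] [|x' v] // _ _; case: (eqVneq x x') => [<-|xx'].
  have [y xy] := letter_neq x.
  rewrite (H _ [:: y]) ?incomparable_cons //; apply: H.
  by rewrite incomparable_cons // eq_sym.
by apply: H; exact: incomparable_cons.
Qed.

Lemma cl_swap_moveR u v v' : incomparable u v -> incomparable u v' -> incomparable v v' ->
  cl (swap u v) = cl (swap u v').
Proof. by move=> I1 I2 I3; rewrite -(swap_conj I1 I2 I3) cl_conj //; exact: VS. Qed.

Lemma cl_swap_moveL u u' v : incomparable u v -> incomparable u' v -> incomparable u u' ->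
  cl (swap u v) = cl (swap u' v).
Proof.
move=> I1 I2 I3; rewrite (swapC I1) (swapC I2).
by apply: cl_swap_moveR; rewrite // incomparableC.
Qed.

(** If some [z] is incomparable with both words, the two cones can be moved one after the other onto
    the children [a] and [b] of [z], which gives the class [c z]; hence [c] is constant on nonempty
    words. In general such a [z] may not exist for [u] and [v], but it does for each of the [d]
    swaps of children: a sibling serves. *)
Lemma cl_swap_const : exists t, forall u v, incomparable u v -> cl (swap u v) = t.
Proof.
have d0 : (0 < d)%N by lia.
pose a := Ordinal d0; have [b ab] := letter_neq a.
pose c z := cl (swap (rcons z a) (rcons z b)).
have E u v z : incomparable u v -> incomparable z u -> incomparable z v ->
    cl (swap u v) = c z.
  move=> I Iu Iv; have Jr w x : incomparable z w -> incomparable (rcons z x) w.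
    by move=> h; rewrite -cats1; exact: incomparable_catl.
  rewrite (@cl_swap_moveR _ _ (rcons z b)) //; try by rewrite incomparableC Jr.
  apply: cl_swap_moveL; rewrite ?incomparable_rcons //; by rewrite incomparableC Jr.
have c_const : forall u v, u != [::] -> v != [::] -> c u = c v.
  apply: incomparable_const => u v I; apply: E; rewrite ?incomparable_rcons //;
    by rewrite -cats1; apply: incomparable_catr; rewrite incomparableC.
exists (c [:: a] *+ d) => u v I; rewrite swap_comps //.
have Ix x y : incomparable (rcons u x) (rcons v y).
  by rewrite -!cats1; apply/incomparable_catl/incomparable_catr.
have [|_ ->] := @cl_comps (fun x => swap (rcons u x) (rcons v x)) (enum 'I_d).
  by move=> x; exact: VS.
rewrite (eq_bigr (fun=> c [:: a])) => [|x _].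
  by rewrite big_const_seq count_predT size_enum_ord -Monoid.iteropE.
have [y xy] := letter_neq x; rewrite (@E _ _ (rcons u y)) //.
- by apply: c_const => //; case: (u).
- by rewrite incomparable_rcons eq_sym.
Qed.

(** The [Phi] of the overview, measured in the cone of the first letter; [cl_localize] shows that
    every other proper cone gives the same value. *)
Definition local_class f := cl (localize [:: Ordinal (ltnW d_ge2)] f).

Lemma cl_localize u f : u != [::] -> V f -> cl (localize u f) = local_class f.
Proof.
move=> u0 Vf; apply: (@incomparable_const _ (fun u => cl (localize u f))) => // v w I.
by rewrite -(localize_conj f I) cl_conj //; exact: VL.
Qed.

Lemma local_class_comp f g : V f -> V g ->
  local_class (f \o g) = local_class f + local_class g.
Proof. by move=> Vf Vg; rewrite /local_class localize_comp clM //; exact: VL. Qed.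

Lemma local_class_id : local_class id = 0.
Proof. by rewrite /local_class localize_id cl_id. Qed.

(** A nested localization is a single localization at a longer nonempty word, and the class does not
    depend on the cone. *)
Lemma local_class_localize u f : V f -> local_class (localize u f) = local_class f.
Proof. by move=> Vf; rewrite {1}/local_class -localize_cat cl_localize. Qed.

Lemma local_class_iter n f : V f ->
  V (iter n f) /\ local_class (iter n f) = local_class f *+ n.
Proof.
move=> Vf; elim: n => [|n [IHV IH]].
  by split; [exact: V1 | exact: local_class_id].
have -> : iter n.+1 f = f \o iter n f by apply: funext.
by rewrite local_class_comp // mulrS IH; split=> //; exact: VM.
Qed.

Lemma local_class_comps F s : (forall x, V (F x)) ->
  local_class (comps F s) = \sum_(x <- s) local_class (F x).
Proof.
move=> VF; elim: s => [|x s IH]; first by rewrite big_nil local_class_id.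
by rewrite big_cons /= local_class_comp // ?IH //; have [] := cl_comps s VF.
Qed.

Definition torsion (q : Q) := exists2 n, (0 < n)%N & q *+ n = 0.

Lemma torsionD q r : torsion q -> torsion r -> torsion (q + r).
Proof.
move=> [m m0 E] [n n0 E']; exists (m * n)%N; first by rewrite muln_gt0 m0.
by rewrite mulrnDl mulrnA E mul0rn mulnC mulrnA E' mul0rn addr0.
Qed.

Lemma torsionN q : torsion q -> torsion (- q).
Proof. by move=> [m m0 E]; exists m; rewrite // mulNrn E oppr0. Qed.

Lemma torsion0 : torsion 0.
Proof. by exists 1%N. Qed.

Lemma torsionMn q n : (0 < n)%N -> torsion (q *+ n) -> torsion q.
Proof. by move=> n0 [m m0 E]; exists (n * m)%N; rewrite ?muln_gt0 ?n0 // mulrnA. Qed.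

Lemma almost_aut_letters s : V (letters s).
Proof.
split.
  exists (letters s^-1) => om.
    by rewrite -[LHS]/((letters s^-1 \o letters s) om) -letters_comp mulgV letters_id.
  by rewrite -[LHS]/((letters s \o letters s^-1) om) -letters_comp mulVg letters_id.
exists 1%N => -[|x []] // _; exists [:: s x], id; first exact: group_id.
by move=> om; rewrite letters_prepend act_id.
Qed.

Lemma torsion_letters s : torsion (local_class (letters s)).
Proof.
exists #[s]%g; first exact: order_gt0.
have H n : local_class (letters (s ^+ n)%g) = local_class (letters s) *+ n.
  elim: n => [|n IH]; first by rewrite letters_id local_class_id.
  rewrite expgSr letters_comp local_class_comp ?IH ?mulrS //; exact: almost_aut_letters.
by rewrite -H expg_order letters_id local_class_id.
Qed.

(** The wreath recursion: first the sections act inside the one-letter cones, then the root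
    permutation of [g] changes the first letter. *)
Lemma act_letters g : G g -> exists s : 'S_d,
  act g = letters s \o comps (fun x => localize [:: x] (act (section g [:: x]))) (enum 'I_d).
Proof.
move=> Gg; have gT := group_tree_aut Ggrp Gg.
pose r x := head x (g [:: x]).
have rE x : g [:: x] = [:: r x].
  by have := tree_aut_size [:: x] gT; rewrite /r; case: (g _) => [|y []].
have rI : injective r.
  move=> x y E; have [/bij_inj gI _] := gT.
  by have [] : [:: x] = [:: y] by apply: gI; rewrite !rE E.
exists (perm rI); apply: funext => om; have [x [w ->]] := iword_cons om.
rewrite (act_prepend Ggrp Gss) // rE /= (@comps_enum _ _ x).
- by rewrite localize_in letters_prepend permE.
- by move=> y yx; rewrite localize_incomparable // incomparable1.
- by move=> y yx; rewrite localize_in localize_incomparable // incomparable1.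
Qed.

Lemma torsion_act g : G g -> torsion (local_class (act g)).
Proof.
move=> Gg; have [s E] := act_letters Gg.
have VA h : G h -> V (act h) by exact: almost_aut_act.
have GS x : G (section g [:: x]) by exact: group_section.
have {E} E : local_class (act g) =
    local_class (letters s) + \sum_x local_class (act (section g [:: x])).
  have VLx x : V (localize [:: x] (act (section g [:: x]))) by apply/VL/VA.
  have [Vc _] := cl_comps (enum 'I_d) VLx.
  rewrite {1}E local_class_comp //; last exact: almost_aut_letters.
  rewrite local_class_comps // big_enum /=; congr (_ + _); apply: eq_bigr => x _.
  by rewrite (local_class_localize _ (VA _ (GS x))).
(* [act g] is [act] of the section composed with a map of finite order by coarse diagonality, so the
   two classes differ by a torsion element. *)
have tx x : torsion (local_class (act g) - local_class (act (section g [:: x]))).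
  have [h [Gh sK hK]] := group_inv Ggrp (GS x).
  have [n [n0 En]] := Gcd Gg (state_section [:: x] (state_self g)) sK hK.
  have Ghg : G (h \o g) by exact: group_comp.
  have -> : act g = act (section g [:: x]) \o act (h \o g).
    rewrite -(act_group_comp Ggrp (GS x) Ghg); congr act; apply: funext => u; exact/esym/hK.
  rewrite (local_class_comp (VA _ (GS x)) (VA _ Ghg)) addrAC subrr add0r; exists n => //.
  have [_ <-] := local_class_iter n (VA _ Ghg).
  have -> : iter n (act (h \o g)) = act (iter n (h \o g)).
    suff [] : G (iter n (h \o g)) /\ iter n (act (h \o g)) = act (iter n (h \o g)) by [].
    elim: {En} n {n0} => [|n [Gn IH]].
      split; first exact: group_id Ggrp.
      have -> : iter 0 (h \o g) = id by apply: funext.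
      by rewrite act_id; apply: funext.
    have -> : iter n.+1 (h \o g) = (h \o g) \o iter n (h \o g) by apply: funext.
    split; first exact: (group_comp Ggrp).
    by rewrite (act_group_comp Ggrp Ghg Gn); apply: funext => om /=; rewrite IH.
  by rewrite En act_id local_class_id.
(* Summing the differences over [x] and inserting [E] gives [d.-1] times the class of [g] plus the
   class of its root permutation, which is torsion. Since [d >= 2], the factor [d.-1] is positive
   and can be removed. *)
have : torsion (local_class (act g) *+ d.-1).
  have -> : local_class (act g) *+ d.-1 =
     \sum_x (local_class (act g) - local_class (act (section g [:: x]))) - local_class (letters s).
    rewrite sumrB sumr_const card_ord -addrA -opprD [in X in - X]addrC -E.
    have dE q : q *+ d = q + q *+ d.-1 :> Q by rewrite -mulrS prednK // ltnW.
    by rewrite dE addrAC subrr add0r.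
  apply: torsionD; last exact/torsionN/torsion_letters.
  by elim/big_ind: _ => // [|q r]; [exact: torsion0|exact: torsionD].
by apply: torsionMn; lia.
Qed.

End Classes.

Lemma inj_surj_bij (T U : Type) (f : T -> U) :
  injective f -> (forall y, exists x, f x = y) -> bijective f.
Proof.
move=> fI /choice[g gK]; exists g => // x; by apply: fI; rewrite gK.
Qed.

(** * Complete prefix codes and leaves of trees *)

Section Codes.
Variable d : nat.
Implicit Types (u v w a b : word d) (A C T : seq (word d)) (om : iword d).

(** Complete prefix codes; for [d > 0] they are the leaf sets of the finite complete rooted
    subtrees, as [code_leaves] and [tree_of_code] show. *)
Definition code A :=
  [/\ uniq A, forall om, exists2 a, a \in A & in_cone a om
    & {in A &, forall a b, prefix a b -> a = b}].

Lemma code_incomparable A : code A -> {in A &, forall a b, a != b -> incomparable a b}.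
Proof.
case=> _ _ H a b aA bA ab; apply/andP; split; apply: contra ab => /H; first by move->.
by move=> -> //.
Qed.

Lemma code_eq A a b om om' : code A -> a \in A -> b \in A ->
  prepend a om = prepend b om' -> a = b.
Proof.
move=> cA aA bA E; apply: contraPeq E => /(code_incomparable cA aA bA).
exact: incomparable_prepend.
Qed.

Lemma code_words N : code [seq tval t | t : N.-tuple 'I_d].
Proof.
split.
- by rewrite map_inj_uniq ?enum_uniq //; exact: val_inj.
- move=> om; exists (mkseq om N); last by rewrite /in_cone size_mkseq.
  have sN : size (mkseq om N) == N by rewrite size_mkseq.
  by apply/imageP; exists (Tuple sN).
- move=> _ _ /imageP[s _ ->] /imageP[t _ ->]; rewrite prefixE size_tuple => /eqP.
  by rewrite take_oversize // size_tuple.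
Qed.

Lemma mem_code_words N u : (u \in [seq tval t | t : N.-tuple 'I_d]) = (size u == N).
Proof.
apply/imageP/eqP => [[t _ ->]|/eqP su]; first by rewrite size_tuple.
by exists (Tuple su).
Qed.

(* [p] is the parent of a longest word of the code. *)
Lemma code_caret A : 0 < d -> code A -> [::] \notin A ->
  exists p, forall x, rcons p x \in A.
Proof.
move=> d0 cA nA; have [_ cov pf] := cA.
have ex : exists n, has (fun a => size a == n) A.
  have [a aA _] := cov (fun=> Ordinal d0).
  by exists (size a); apply/hasP; exists a.
have bd n : has (fun a => size a == n) A -> n <= \max_(a <- A) size a.
  by move=> /hasP[a aA /eqP<-]; apply: leq_bigmax_seq.
case: (ex_maxnP ex bd) => n /hasP[a aA /eqP sa] maxn.
case: (lastP a) aA sa => [|p x] pA sa; first by rewrite pA in nA.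
exists p => y.
have [b bA /in_coneP[w E]] := cov (prepend (rcons p y) (fun=> Ordinal d0)).
have sb : size b <= size (rcons p y).
  rewrite size_rcons -(size_rcons p x) sa; apply: maxn; apply/hasP; by exists b.
have [t Et _] := prepend_eq_prefix (esym E) sb.
case: (lastP t) Et => [|t' z]; first by rewrite cats0 => ->.
rewrite -rcons_cat => /rcons_inj[Ep _].
have : b = rcons p x by apply: pf => //; rewrite Ep -cats1 -catA prefix_prefix.
by move/(congr1 size); rewrite size_rcons Ep size_cat; lia.
Qed.

Definition contract p A :=
  p :: [seq a <- A | a \notin [seq rcons p x | x : 'I_d]].

Lemma mem_contract p A a : (a \in contract p A) =
  (a == p) || (a \notin [seq rcons p x | x : 'I_d]) && (a \in A).
Proof. by rewrite inE mem_filter. Qed.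

(** By prefix-freeness no word of [A] is a prefix of [p], and the only extensions of [p] in [A] are
    its children. Replacing these by [p] thus keeps the code prefix-free and covering. *)
Lemma code_contract p A : 0 < d -> code A -> (forall x, rcons p x \in A) ->
  code (contract p A).
Proof.
move=> d0 cA pA; have [uA cov pf] := cA.
have np a : a \in A -> prefix a p -> False.
  move=> aA ap; have := pf _ _ aA (pA (Ordinal d0)).
  rewrite -cats1 (prefix_trans ap (prefix_prefix _ _)) => /(_ isT) E.
  move: ap; rewrite E prefixE take_oversize ?size_cat /= ?leq_addr //.
  by move=> /eqP/(congr1 size); rewrite size_cat /=; lia.
have pn a : a \in A -> a \notin [seq rcons p x | x : 'I_d] -> ~~ prefix p a.
  move=> aA; apply: contra => /prefixP[[|x t] E].
    by case: (np _ aA); rewrite E cats0 prefix_refl.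
  rewrite -cat_rcons in E; apply/imageP; exists x => //; apply/esym.
  by apply: pf => //; rewrite E prefix_prefix.
split.
- rewrite /= filter_uniq // andbT mem_filter negb_and; apply/orP; right.
  by apply/negP => /np; apply; exact: prefix_refl.
- move=> om; have [a aA ao] := cov om.
  case: (boolP (a \in [seq rcons p x | x : 'I_d])) => h; last first.
    by exists a; rewrite // mem_contract h aA orbT.
  exists p; first by rewrite mem_contract eqxx.
  have /imageP[x _ E] := h; have /in_coneP[w ->] := ao.
  by rewrite E prepend_rcons in_cone_prepend.
- move=> a b; rewrite !mem_contract => /orP[/eqP->|/andP[na aA]] /orP[/eqP->|/andP[nb bA]] //.
  + by rewrite (negPf (pn _ bA nb)).
  + by move=> /np -/(_ aA).
  + exact: pf.
Qed.

(** At least two children give way to one word: two distinct children together with the retained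
    words [F] still lie in [A]. *)
Lemma size_contract p A : 1 < d -> uniq A -> (forall x, rcons p x \in A) ->
  size (contract p A) < size A.
Proof.
move=> d1 uA pA; have d0 : 0 < d by lia.
have <- : size (rcons p (Ordinal d0) :: contract p A) = (size (contract p A)).+1 by [].
pose F := [seq a <- A | a \notin [seq rcons p x | x : 'I_d]].
have -> : size (rcons p (Ordinal d0) :: contract p A)
          = size (rcons p (Ordinal d0) :: rcons p (Ordinal d1) :: F) by [].
apply: uniq_leq_size => /=.
  have nF x : rcons p x \notin F.
    by rewrite mem_filter negb_and negbK; apply/orP; left; apply/imageP; exists x.
  rewrite inE negb_or !nF filter_uniq // !andbT.
  by apply/eqP => /rcons_inj[].
move=> a; rewrite !inE => /or3P[/eqP->|/eqP->|] //.
by rewrite mem_filter => /andP[].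
Qed.

Lemma mem_leaves T u : u \in leaves T = (u \in T) && [forall x, rcons u x \notin T].
Proof.
rewrite mem_sort mem_filter mem_undup andbC; congr (_ && _).
by apply/allP/forallP => [H x|H x _]; [apply: H; rewrite mem_enum|exact: H].
Qed.

Lemma leaves_uniq T : uniq (leaves T).
Proof. by rewrite sort_uniq filter_uniq // undup_uniq. Qed.

Lemma code_leaves T : complete_rooted_subtree T -> code (leaves T).
Proof.
move=> [T0 [Tp Tc]]; split; first exact: leaves_uniq.
(* The longest prefix of [om] in [T] is a leaf: with one child in [T], completeness would put the
   next prefix of [om] in [T] too. *)
- move=> om; have ex : exists n, mkseq om n \in T by exists 0.
  have bd n : mkseq om n \in T -> n <= \max_(t <- T) size t.
    move=> h; rewrite -{1}(size_mkseq om n).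
    by apply: (@leq_bigmax_seq _ T xpredT (fun t => size t)).
  case: (ex_maxnP ex bd) => n nT maxn; exists (mkseq om n).
    rewrite mem_leaves nT; apply/forallP => x; apply/negP => h.
    by have := maxn n.+1; rewrite mkseqS (Tc _ _ _ h) ltnn => /(_ isT).
  by rewrite /in_cone size_mkseq.
- have Tcat u t : u ++ t \in T -> u \in T.
    elim/last_ind: t => [|t x IH]; first by rewrite cats0.
    by rewrite -rcons_cat => /Tp.
  move=> a b; rewrite !mem_leaves => /andP[_ /forallP aL] /andP[bT _] /prefixP[[|x t] E].
    by rewrite E cats0.
  by have := aL x; rewrite (Tcat _ t) // cat_rcons -E.
Qed.

(** The tree consists of all prefixes of code words. For completeness, a code word comparable with
    the sibling [rcons u y] cannot be a prefix of [u], because [u] is a proper prefix of another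
    code word. *)
Lemma tree_of_code C : 0 < d -> code C ->
  exists2 T, complete_rooted_subtree T & leaves T =i C.
Proof.
move=> d0 [uC cov pf].
pose T := flatten [seq [seq take i c | i <- iota 0 (size c).+1] | c <- C].
have TP u : reflect (exists2 c, c \in C & prefix u c) (u \in T).
  apply: (iffP flatten_mapP) => -[c cC].
    by case/mapP => i _ ->; exists c => //; exact: prefix_take.
  move=> h; exists c => //; apply/mapP; exists (size u).
    by rewrite mem_iota add0n leq0n ltnS /=; case/prefixP: h => t ->; rewrite size_cat leq_addr.
  by move: h; rewrite prefixE => /eqP.
have pr u x : prefix u (rcons u x) by rewrite -cats1 prefix_prefix.
have nlong u x c : prefix (rcons u x) c -> prefix c u -> False.
  move=> /prefixP[t ->] /prefixP[s /(congr1 size)].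
  by rewrite !size_cat size_rcons; lia.
exists T; [split; [|split]|].
- by have [c cC _] := cov (fun=> Ordinal d0); apply/TP; exists c => //; exact: prefix0s.
- by move=> u x /TP[c cC h]; apply/TP; exists c => //; exact: prefix_trans h.
- move=> u x y /TP[c cC h].
  have [c' c'C /in_coneP[w E]] := cov (prepend (rcons u y) (fun=> Ordinal d0)).
  apply/TP; exists c' => //.
  case/orP: (prepend_eq_comparable E) => // /prefixP[t Et].
  case: (lastP t) Et => [|t' z]; first by rewrite cats0 => ->; exact: prefix_refl.
  rewrite -rcons_cat => /rcons_inj[Eu _].
  have c'u : prefix c' u by rewrite Eu prefix_prefix.
  have E' : c' = c by apply: pf => //; apply: prefix_trans c'u (prefix_trans _ h); exact: pr.
  by case: (nlong _ _ _ h); rewrite -E'.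
- move=> u; rewrite mem_leaves; apply/andP/idP => [[/TP[c cC /prefixP[[|x t] E]] /forallP H]|uC'].
  + by rewrite E cats0 in cC.
  + by have /TP[] := H x; exists c => //; rewrite E -cat_rcons prefix_prefix.
  + split; first by apply/TP; exists u => //; exact: prefix_refl.
    apply/forallP => x; apply/negP => /TP[c cC h].
    have E : u = c by apply: pf => //; apply: prefix_trans h; exact: pr.
    by apply: (nlong _ _ _ h); rewrite E prefix_refl.
Qed.

End Codes.

(** * Tables of bijections over codes *)

Section Tables.
Variables (d : nat) (G : tfun d -> Prop).
Hypotheses (d_ge2 : 2 <= d) (Ggrp : subgroup_aut G) (Gss : self_similar G).
Implicit Types (u v w a b p q : word d) (A : seq (word d)) (om : iword d).
Implicit Types (f : iword d -> iword d).

Let d_gt0 : 0 < d. Proof. exact: ltnW. Qed.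

Definition table f A := forall a, a \in A -> exists v, prefix_action G f a v.

(** Elements of [G] act surjectively on infinite words, so a row maps its cone onto the image cone
    and a common image point can be pulled back on both sides. *)
Lemma prefix_action_meet f a b v w om om' : prefix_action G f a v -> prefix_action G f b w ->
  bijective f -> prepend v om = prepend w om' ->
  exists om1 om2, prepend a om1 = prepend b om2.
Proof.
move=> [g Gg E] [h Gh E'] /bij_inj fI Evw.
have [g' _ gK] := act_bij Ggrp Gg; have [h' _ hK] := act_bij Ggrp Gh.
by exists (g' om), (h' om'); apply: fI; rewrite E E' gK hK.
Qed.

Lemma prefix_action_incomparable f a b v w : prefix_action G f a v -> prefix_action G f b w ->
  bijective f -> incomparable v w -> a <> b.
Proof.
move=> [g Gg E] [h Gh E'] fB I Eab; pose om : iword d := fun=> Ordinal d_gt0.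
by apply: (@incomparable_prepend _ v w (act g om) (act h om) I); rewrite -E -E' Eab.
Qed.

(** Image cones of distinct rows cannot meet because [f] is injective, and they cover everything
    because [f] is surjective. *)
Lemma code_image f A : bijective f -> code A -> table f A ->
  exists u : word d -> word d, [/\ forall a, a \in A -> prefix_action G f a (u a),
    {in A &, injective u} & code (map u A)].
Proof.
move=> fB cA tA; have [uA cov pf] := cA.
have /choice[u Hu] : forall a, exists v, a \in A -> prefix_action G f a v.
  move=> a; case: (boolP (a \in A)) => [/tA[v Hv]|]; first by exists v.
  by exists a.
exists u; have key a b : a \in A -> b \in A -> prefix (u a) (u b) -> a = b.
  move=> aA bA /prefixP[t E]; pose om : iword d := fun=> Ordinal d_gt0.
  have [|o1 [o2 Eab]] :=
    @prefix_action_meet f a b _ _ (prepend t om) om (Hu _ aA) (Hu _ bA) fB.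
    by rewrite E prepend_cat.
  exact: (code_eq cA aA bA Eab).
have uI : {in A &, injective u}.
  by move=> a b aA bA E; apply: key => //; rewrite E; exact: prefix_refl.
split=> //; split; first by rewrite map_inj_in_uniq.
- have [f' fK f'K] := fB; move=> om; have [a aA /in_coneP[w E]] := cov (f' om).
  exists (u a); first exact: map_f.
  have [g _ Ea] := Hu _ aA; apply/in_coneP; exists (act g w).
  by rewrite -Ea -E f'K.
- by move=> _ _ /mapP[a aA ->] /mapP[b bA ->] /(key _ _ aA bA) ->.
Qed.

(** The cone of [a] is mapped onto everything; were [a] nonempty, a word with another first letter
    would share its image with a word of that cone. *)
Lemma prefix_action_nil f a : prefix_action G f a [::] -> bijective f -> a = [::].
Proof.
move=> [g Gg E] /bij_inj fI; case: a E => // x a E; exfalso.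
have [y xy] := letter_neq d_ge2 x; pose om : iword d := fun=> y.
have [g' _ gK] := act_bij Ggrp Gg.
have /fI : f (prepend (x :: a) (g' (f om))) = f om by rewrite E prepend_nil gK.
move/(congr1 (fun o => o 0)); rewrite /prepend /= => yx.
by rewrite yx eqxx in xy.
Qed.

(** * Generation by swaps and localized elements, as an induction principle for a predicate [K] *)

Section Generation.
Variable K : (iword d -> iword d) -> Prop.
Hypotheses (K1 : K id)
  (KS : forall f u v, incomparable u v -> K f -> K (f \o swap u v))
  (KL : forall f u g, u != [::] -> G g -> K f -> K (f \o localize u (act g))).

Definition exchange a b c : word d := if c == a then b else if c == b then a else c.

(** Precomposition with [swap a b] permutes two rows. For [a = b] the map is kept, since [swapK]
    concerns incomparable words only. *)
Lemma exchange_swap f A a b : code A -> a \in A -> b \in A -> bijective f ->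
  exists f', [/\ K f' -> K f, bijective f' & forall c om, c \in A ->
    f' (prepend (exchange a b c) om) = f (prepend c om)].
Proof.
move=> cA aA bA fB; case: (eqVneq a b) => [<-|ab].
  exists f; split=> // c om _; rewrite /exchange; by case: eqP => // ->.
have I := code_incomparable cA aA bA ab.
have SK : bijective (swap a b) by exists (swap a b); exact: swapK.
exists (f \o swap a b); split=> [Kf||c om cA' /=].
- have -> : f = (f \o swap a b) \o swap a b by apply: funext => om /=; rewrite swapK.
  exact: KS.
- exact: bij_comp.
rewrite /exchange; case: (eqVneq c a) => [->|ca]; first by rewrite swapr.
case: (eqVneq c b) => [->|cb]; first by rewrite swapl.
by rewrite swap_incomparable //; apply: (code_incomparable cA); rewrite // eq_sym.
Qed.

(* [f'] is [f] precomposed with swaps and localized elements of [G], of which only the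
   implication [K f' -> K f] is recorded. *)
Lemma align_caret f A p q s : code A -> (forall x, rcons p x \in A) ->
  bijective f -> table f A ->
  (forall x, exists2 v, v \in A & prefix_action G f v (rcons q x)) -> uniq s ->
  exists f', [/\ K f' -> K f, bijective f', table f' A,
    forall x om, x \in s -> f' (prepend (rcons p x) om) = prepend (rcons q x) om
    & forall x, exists2 v, v \in A & prefix_action G f' v (rcons q x)].
Proof.
move=> cA pA fB tA qA; elim: s => [|x s IH] /=; first by exists f; split.
case/andP=> xs /IH[{IH} f0 [K0 f0B t0 E0 q0]] {fB tA qA}.
have [v vA Hv] := q0 x; set px := rcons p x.
have [f1 [K1' f1B E1]] := exchange_swap cA vA (pA x) f0B.
have [g Gg Eg] := Hv; have [h [Gh gK hK]] := group_inv Ggrp Gg.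
have hgK := act_cancel Ggrp Gh Gg hK; have ghK := act_cancel Ggrp Gg Gh gK.
have Ex c : exchange v px (exchange v px c) = c.
  rewrite /exchange; case: (eqVneq c v) => [->|cv].
    by case: eqP => //; rewrite eqxx.
  by case: (eqVneq c px) => [->|/negPf cp]; rewrite ?eqxx // (negPf cv) cp.
have ExA c : c \in A -> exchange v px c \in A.
  by move=> cA'; rewrite /exchange; case: eqP => _; [exact: pA | case: eqP].
have I c : c \in A -> c != px -> incomparable px c.
  by move=> cA' cp; apply: (code_incomparable cA); rewrite // ?pA // eq_sym.
(* The exchange has put the row of [v] at [px]; acting there first by the inverse [h] of its group
   element leaves a pure change of prefix. *)
pose f2 := f1 \o localize px (act h).
have E2 om : f2 (prepend px om) = prepend (rcons q x) om.
  rewrite /f2 /= localize_in; have := E1 v (act h om) vA.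
  by rewrite /exchange eqxx => ->; rewrite Eg hgK.
have E2' c om : c \in A -> c != px -> f2 (prepend c om) = f0 (prepend (exchange v px c) om).
  move=> cA' cp; rewrite /f2 /= localize_incomparable ?I //.
  by rewrite -[in LHS](Ex c) E1 // ExA.
have P2 : prefix_action G f2 px (rcons q x).
  by exists id; [exact: group_id Ggrp | move=> om; rewrite E2 act_id].
have px0 : px != [::] by rewrite /px; case: (p).
have locK (k l : tfun d) : cancel (act k) (act l) ->
    localize px (act l) \o localize px (act k) = id.
  by move=> kl; rewrite -localize_comp (funext kl : act l \o act k = id) localize_id.
exists f2; split.
- move=> Kf2; apply/K0/K1'; have -> : f1 = f2 \o localize px (act g).
    by rewrite /f2 -compA locK.
  exact: KL.
- apply: bij_comp => //; exists (localize px (act g)) => om.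
    by rewrite -[LHS]/((localize px (act g) \o localize px (act h)) om) locK.
  by rewrite -[LHS]/((localize px (act h) \o localize px (act g)) om) locK.
- move=> a aA; case: (eqVneq a px) => [->|ap]; first by exists (rcons q x).
  have [b [k Gk Ek]] := t0 _ (ExA _ aA); exists b, k => // om.
  by rewrite E2' // Ek.
- move=> y om; rewrite inE; case: (eqVneq y x) => [-> _|yx /= ys]; first exact: E2.
  have pyx : rcons p y != px by apply: contraNneq yx => /rcons_inj[->].
  (* Rows aligned earlier are not disturbed: the one at [rcons p y] goes to the cone of [rcons q y],
     which is disjoint from the image cone of the row [v]. *)
  have pyv : rcons p y != v.
    have Hy : prefix_action G f0 (rcons p y) (rcons q y).
      by exists id; [exact: group_id Ggrp | move=> om'; rewrite E0 // act_id].
    apply/eqP; apply: (prefix_action_incomparable Hy Hv f0B).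
    by rewrite incomparable_rcons.
  by rewrite E2' // /exchange (negPf pyv) (negPf pyx) E0.
- move=> y; case: (eqVneq y x) => [->|yx]; first by exists px => //; exact: pA.
  have [v' v'A Hv'] := q0 y; exists (exchange v px v'); first exact: ExA.
  have v'v : v' != v.
    by apply/eqP; apply: (prefix_action_incomparable Hv' Hv f0B); rewrite incomparable_rcons.
  have np : exchange v px v' != px.
    rewrite /exchange (negPf v'v); case: (eqVneq v' px) => // E.
    by rewrite -E eq_sym.
  have [k Gk Ek] := Hv'; exists k => // om.
  by rewrite E2' ?ExA // Ex.
Qed.

Lemma generation_code f A : code A -> [::] \notin A -> bijective f -> table f A -> K f.
Proof.
have [n] := ubnP (size A); elim: n => // n IH in f A *.
rewrite ltnS => sA cA nA fB tA.
have [p pA] := code_caret d_gt0 cA nA.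
have [u [Hu uI cB]] := code_image fB cA tA.
have nB : [::] \notin map u A.
  apply/mapP => -[a aA E]; have := Hu _ aA; rewrite -E => /prefix_action_nil/(_ fB) Ea.
  by rewrite -Ea aA in nA.
have [q qB] := code_caret d_gt0 cB nB.
have qA x : exists2 v, v \in A & prefix_action G f v (rcons q x).
  by have /mapP[v vA ->] := qB x; exists v => //; exact: Hu.
have [f' [Kf' f'B t' E' _]] := align_caret cA pA fB tA qA (enum_uniq 'I_d).
apply: Kf'.
have Ep om : f' (prepend p om) = prepend q om.
  have [x [om' ->]] := iword_cons om; rewrite -!prepend_rcons E' //.
  by rewrite mem_enum.
(* At the root [f'] is a change of prefix on all words, so surjectivity makes [q] the root as well
   and [f'] the identity. Otherwise the caret contracts to the single row [p] and the induction
   applies. *)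
case: (eqVneq p [::]) => [p0|p0].
  have q0 : q = [::].
    have [h h1 _] := f'B; have [h' _ h2] := f'B.
    case: q Ep {qA qB E'} => // y q Ep; exfalso.
    have [z yz] := letter_neq d_ge2 y.
    have := h2 (fun=> z); rewrite -(prepend_nil (h' _)) -p0 Ep.
    by move/(congr1 (fun o => o 0)); rewrite /prepend /= => E; rewrite E eqxx in yz.
  suff -> : f' = id by [].
  by apply: funext => om; have := Ep om; rewrite p0 q0 !prepend_nil.
have [uA _ _] := cA.
apply: (IH _ (contract p A)) => //.
- exact: leq_trans (size_contract d_ge2 uA pA) sA.
- exact: code_contract.
- by rewrite mem_contract (negPf nA) andbF orbF eq_sym.
- move=> a; rewrite mem_contract => /orP[/eqP->|/andP[_ /t']] //.
  by exists q, id; [exact: group_id Ggrp | move=> om; rewrite act_id].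
Qed.

Theorem generation f : almost_aut G f -> K f.
Proof.
(* The level is [N + 1] so that the root is not in the code even when [N = 0]. *)
move=> [fB [N H]]; apply: (@generation_code f [seq tval t | t : (N + 1).-tuple 'I_d]) => //.
- exact: code_words.
- by rewrite mem_code_words addn1.
- move=> a; rewrite mem_code_words => /eqP sa.
  by have [v _ Hv] := prefix_action_deep Ggrp Gss H sa; exists v.
Qed.

End Generation.

(** * Comparison with the definition by pairs of trees *)

Lemma almost_aut_of_Vd f : is_Vd_elt G f -> almost_aut G f.
Proof.
move=> [Tm [Tp [n [s [gs [cm [cp [sm [sp [Ggs E]]]]]]]]]].
have Cm := code_leaves cm; have Cp := code_leaves cp.
have [um covm _] := Cm; have [up covp _] := Cp.
have idx (T : seq (word d)) (i : 'I_n) : size (leaves T) = n -> nth [::] (leaves T) i \in leaves T.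
  by move=> sT; apply: mem_nth; rewrite sT.
have dom om : exists (i : 'I_n) om', om = prepend (nth [::] (leaves Tp) i) om'.
  have [a aA /in_coneP[w ->]] := covp om.
  have lt : index a (leaves Tp) < n by rewrite -sp index_mem.
  by exists (Ordinal lt), w; rewrite nth_index.
split.
  apply: inj_surj_bij => [o1 o2|om].
    have [i [w ->]] := dom o1; have [j [w' ->]] := dom o2; rewrite !E => Eij.
    have := code_eq Cm (idx _ _ sm) (idx _ _ sm) Eij.
    move/eqP; rewrite nth_uniq ?sm // => /eqP/ord_inj/perm_inj ij.
    move: Eij; rewrite ij => /prepend_inj; have /bij_inj gI := act_bij Ggrp (Ggs j).
    by move/gI ->.
  have [a aA /in_coneP[w ->]] := covm om.
  have lt : index a (leaves Tm) < n by rewrite -sm index_mem.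
  pose i := (s^-1)%g (Ordinal lt); have [h _ hK] := act_bij Ggrp (Ggs i).
  exists (prepend (nth [::] (leaves Tp) i) (h w)).
  by rewrite E hK permKV /= nth_index.
(* A word as long as the longest leaf of [Tp] extends some leaf, whose row is then refined. *)
pose N := \max_(t <- leaves Tp) size t; exists N => u su.
have [i [w Ew]] := dom (prepend u (fun=> Ordinal d_gt0)).
have le : size (nth [::] (leaves Tp) i) <= size u.
  by rewrite su; apply: (@leq_bigmax_seq _ _ xpredT (fun t => size t)) => //; exact: idx.
have [t -> _] := prepend_eq_prefix (esym Ew) le.
have Hi : prefix_action G f (nth [::] (leaves Tp) i) (nth [::] (leaves Tm) (s i)).
  by exists (gs i) => //; move=> om; exact: E.
by have [t' _ Ht] := prefix_action_cat Ggrp Gss t Hi; eexists; exact: Ht.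
Qed.

(** The domain tree has the words of level [N] as leaves, the range tree their image prefixes; the
    permutation records the lexicographic position of each image prefix. *)
Lemma Vd_of_almost_aut f : almost_aut G f -> is_Vd_elt G f.
Proof.
move=> [fB [N H]]; pose A := [seq tval t | t : N.-tuple 'I_d].
have cA : code A := code_words d N.
have tA : table f A by move=> a; rewrite mem_code_words => /eqP; exact: H.
have [u [Hu uI cB]] := code_image fB cA tA.
have [Tp cp Lp] := tree_of_code d_gt0 cA; have [Tm cm Lm] := tree_of_code d_gt0 cB.
have [uA _ _] := cA; have [uB _ _] := cB.
pose n := size (leaves Tp).
have sn : n = size A by apply/perm_size/uniq_perm; rewrite ?leaves_uniq.
have sm : size (leaves Tm) = n.
  by rewrite sn -(size_map u A); apply/perm_size/uniq_perm; rewrite ?leaves_uniq.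
pose l (i : 'I_n) := nth [::] (leaves Tp) i.
have lA i : l i \in A by rewrite -Lp mem_nth.
have ulB i : u (l i) \in leaves Tm by rewrite Lm map_f.
have lt i : index (u (l i)) (leaves Tm) < n by rewrite -sm index_mem.
have sI : injective (fun i => Ordinal (lt i)).
  move=> i j [/(congr1 (nth [::] (leaves Tm)))]; rewrite !nth_index // => Eij.
  by have /eqP := uI _ _ (lA i) (lA j) Eij; rewrite nth_uniq ?leaves_uniq // => /eqP/ord_inj.
have /choice[gs Hgs] : forall i : 'I_n, exists g, G g /\
    forall om, f (prepend (l i) om) = prepend (u (l i)) (act g om).
  by move=> i; have [g Gg E] := Hu _ (lA i); exists g.
exists Tm, Tp, n, (perm sI), gs; do !split=> //; first by move=> i; case: (Hgs i).
move=> i w; have [_ ->] := Hgs i; by rewrite permE /= nth_index.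
Qed.

End Tables.

(** * From torsion generators to a finite abelianization *)

Lemma finite_torsion_subgroup (Q : zmodType) (ys : seq Q) :
  (forall y, y \in ys -> torsion y) ->
  exists L : seq Q, [/\ 0%R \in L, {subset ys <= L},
    forall x y, x \in L -> y \in L -> (x + y)%R \in L
    & forall x, x \in L -> (- x)%R \in L].
Proof.
elim: ys => [|y ys IH] H.
  exists [:: 0%R]; split=> [|//|x y|x]; rewrite !inE //.
    by move=> /eqP-> /eqP->; rewrite addr0.
  by move=> /eqP->; rewrite oppr0.
have [|L [L0 LS LD LN]] := IH; first by move=> z zs; apply: H; rewrite inE zs orbT.
have [|n n0 yn] := H y; first exact: mem_head.
have yE k : (y *+ k = y *+ (k %% n))%R.
  by rewrite {1}(divn_eq k n) mulrnDr mulnC mulrnA yn mul0rn add0r.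
(* Generators are adjoined one at a time; multiples of [y] matter only modulo [n], which keeps the
   list finite and closed. *)
pose L' := [seq (y *+ e + z)%R | e <- iota 0 n, z <- L].
have LP k z : z \in L -> (y *+ k + z)%R \in L'.
  move=> zL; apply/allpairsP; exists (k %% n, z); split=> //=; last by rewrite yE.
  by rewrite mem_iota add0n ltn_mod.
have LE x : x \in L' -> exists k z, z \in L /\ x = (y *+ k + z)%R.
  by case/allpairsP => -[k z] [_ zL ->]; exists k, z.
exists L'; split.
- by have := LP 0 _ L0; rewrite mulr0n addr0.
- move=> z; rewrite inE => /orP[/eqP->|/LS zL].
    by have := LP 1 _ L0; rewrite mulr1n addr0.
  by have := LP 0 _ zL; rewrite mulr0n add0r.
- move=> _ _ /LE[k [z [zL ->]]] /LE[k' [z' [zL' ->]]].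
  by rewrite addrACA -mulrnDr; apply: LP; exact: LD.
- move=> _ /LE[k [z [zL ->]]]; rewrite opprD.
  have -> : (- (y *+ k) = y *+ (k * n.-1))%R.
    apply/eqP; rewrite eq_sym -addr_eq0 -mulrnDr -mulnSr prednK // mulnC mulrnA yn.
    by rewrite mul0rn.
  by apply: LP; exact: LN.
Qed.

Lemma finite_abelianization_of_image (d : nat) (V : (iword d -> iword d) -> Prop)
    (Q : zmodType) (cl : (iword d -> iword d) -> Q) (L : seq Q) :
  V id -> (forall x y, V x -> V y -> V (x \o y)) ->
  (forall x, V x -> exists y, [/\ V y, cancel x y & cancel y x]) ->
  (forall x y, V x -> V y -> cl (x \o y) = (cl x + cl y)%R) ->
  (forall x, V x -> cl x = 0%R -> comm_sub V x) ->
  (forall x, V x -> cl x \in L) -> finite_abelianization V.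
Proof.
move=> V1 VM VV clM ker clL.
(* [r q] has value [q] whenever some element of [V] does, and may be [id] otherwise; one such
   representative per value suffices because the kernel consists of products of commutators. *)
have /choice[r Hr] : forall q, exists x, V x /\ ((exists2 y, V y & cl y = q) -> cl x = q).
  move=> q; case: (pselect (exists2 y, V y & cl y = q)) => [[y Vy E]|n]; first by exists y.
  by exists id.
exists (size L), (fun i : 'I_(size L) => r (nth 0%R L i)); split.
  by move=> j; case: (Hr (nth 0%R L j)).
move=> v Vv; have lt : index (cl v) L < size L by rewrite index_mem clL.
have [Vr Er] := Hr (cl v); have [r' [Vr' rK r'K]] := VV _ Vr.
have {}Er : cl (r (cl v)) = cl v by apply: Er; exists v.
exists (Ordinal lt), (r' \o v); split; last first.
  by rewrite /= nth_index ?clL //; apply: funext => om /=; rewrite r'K.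
apply: ker; first exact: VM.
rewrite clM // -Er -clM // (funext rK : r' \o r (cl v) = id).
by apply: (addrI (cl id)); rewrite addr0 -clM.
Qed.

Lemma abelianization_almost_aut (d : nat) (G : tfun d -> Prop) :
  2 <= d -> subgroup_aut G -> fin_generated G -> coarsely_diagonal G -> self_similar G ->
  finite_abelianization (almost_aut G).
Proof.
move=> d2 Ggrp [k [gens [Ggens gen]]] Gcd Gss.
have VM f g := @almost_aut_comp _ _ Ggrp Gss f g.
have V1 := almost_aut_id Ggrp.
have VV f : almost_aut G f -> exists g, [/\ almost_aut G g, cancel f g & cancel g f].
  move=> Vf; have [[g fK gK] _] := Vf; exists g; split=> //.
  exact: almost_aut_inv Vf fK gK.
have VA g : G g -> almost_aut G (act g) by exact: almost_aut_act.
have [Q [cl [clM ker]]] := abelianization_exists V1 VM VV.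
have [t Et] := cl_swap_const d2 Ggrp Gss clM.
pose Phi := local_class d2 cl.
have [|L [L0 LS LD LN]] := @finite_torsion_subgroup Q (t :: [seq Phi (act (gens i)) | i : 'I_k]).
  move=> y; rewrite inE => /orP[/eqP->|/imageP[i _ ->]]; last first.
    exact: (torsion_act d2 Ggrp Gss Gcd clM (Ggens i)).
  have d0 : 0 < d by lia.
  have I : incomparable [:: Ordinal d0] [:: Ordinal d2] by rewrite incomparable1.
  by exists 2 => //; rewrite mulr2n -(Et _ _ I); exact: (cl_swap2 Ggrp clM).
have PhiM f g : almost_aut G f -> almost_aut G g -> Phi (f \o g) = (Phi f + Phi g)%R.
  exact: (local_class_comp d2 Ggrp clM).
have Phi1 : Phi id = 0%R by exact: (local_class_id d2 Ggrp clM).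
have LG g : G g -> Phi (act g) \in L.
  move=> /[dup] /gen Hg _; suff [] : G g /\ Phi (act g) \in L by [].
  have PL i : Phi (act (gens i)) \in L.
    by apply: LS; rewrite inE; apply/orP; right; apply/imageP; exists i.
  elim: {g} Hg => [|i f _ [Gf IH]|i h f hK Kh _ [Gf IH]].
  - by split; [exact: group_id Ggrp | rewrite act_id Phi1].
  - split; first exact: (group_comp Ggrp).
    by rewrite (act_group_comp Ggrp (Ggens i) Gf) PhiM ?LD //; exact: VA.
  - have [h' [Gh' gK Kg]] := group_inv Ggrp (Ggens i).
    (* Two-sided inverses are unique, so the inverse supplied by [gen_inv] lies in [G]. *)
    have Eh : h = h' by apply: funext => w; rewrite -{1}(Kg w) hK.
    rewrite Eh; split; first exact: (group_comp Ggrp).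
    rewrite (act_group_comp Ggrp Gh' Gf) PhiM ?LD //; try exact: VA.
    suff -> : Phi (act h') = (- Phi (act (gens i)))%R by exact: LN.
    apply/eqP; rewrite -addr_eq0 -PhiM; try exact: VA.
    rewrite -(act_group_comp Ggrp Gh' (Ggens i)).
    by rewrite (funext gK : h' \o gens i = id) act_id Phi1.
apply: (@finite_abelianization_of_image _ _ _ cl L) => // v Vv.
suff [] : almost_aut G v /\ cl v \in L by [].
(* The predicate carries membership in the group along, since [cl] is known to be additive only
   there. *)
apply: (generation (K := fun f => almost_aut G f /\ cl f \in L) d2 Ggrp Gss) Vv.
- by split=> //; rewrite (cl_id Ggrp clM).
- move=> f a b I [Vf fL]; have VS := almost_aut_swap Ggrp I.
  by split; [exact: VM | rewrite clM // LD // (Et _ _ I) LS // mem_head].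
- move=> f u g u0 Gg [Vf fL]; have VL := almost_aut_localize Ggrp u (VA _ Gg).
  split; first exact: VM.
  rewrite clM // LD // (cl_localize d2 Ggrp Gss clM u0 (VA _ Gg)); exact: LG.
Qed.

Theorem theorem3p3 (d : nat) (G : tfun d -> Prop) :
  (2 <= d)%N ->
  subgroup_aut G ->
  fin_generated G ->
  coarsely_diagonal G ->
  self_similar G ->
  finite_abelianization (is_Vd_elt G).
Proof.
move=> d2 Ggrp Gfg Gcd Gss.
have -> : is_Vd_elt G = almost_aut G.
  apply: funext => f; apply: propext; split; first exact: almost_aut_of_Vd.
  exact: Vd_of_almost_aut.
exact: abelianization_almost_aut.
Qed.
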